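(* Consider a fixed transport discretization, consisting of a finite control-volume mesh, a given velocity field $\mathbf u$ (through its face normal values), and a time step $\Delta t>0$, with constant porosity $\varepsilon>0$. Let $A_{\mathrm{up}}$ be the associated implicit upwind control-volume matrix and $b$ the associated right-hand side, as defined in the context. Let $c$ be the exact cellwise concentration, $A_{\mathrm{up}}c=b$; let $\tilde c$ be an approximation (a vector of cell values), let $e_c:=\tilde c-c$, and let $r_{\mathrm{up}}:=A_{\mathrm{up}}\tilde c-b$ (so $r_{\mathrm{up}}=A_{\mathrm{up}}e_c$). Then there exist constants $C_1,C_2>0$, independent of $\tilde c$, such that $$C_1\,\|e_c\|_{\mathcal E,\mathrm{tr}}\le\|r_{\mathrm{up}}\|_2\le C_2\,\|e_c\|_{\mathcal E,\mathrm{tr}},$$ where $\|\cdot\|_2$ is the Euclidean norm and $\|\cdot\|_{\mathcal E,\mathrm{tr}}$ is the transport energy norm defined in the context.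
   Context: Mesh: finitely many cells $K$ with measure $|K|>0$; faces $f$ with measure $|f|$; $f=K|L$ denotes the interior face shared by cells $K$ and $L$; $\mathbf n_{K,f}$ is the unit normal on $f$ pointing outward from $K$ (so $\mathbf n_{L,f}=-\mathbf n_{K,f}$), and $(\mathbf u\cdot\mathbf n_{K,f})_f$ is the given single-valued normal velocity on $f$. Upwind control-volume balance for one substep $t^m\to t^{m+1}$: for every cell $K$, $$\varepsilon\,\frac{c_K^{m+1}-c_K^m}{\Delta t}\,|K|+\sum_{f\subset\partial K}(\mathbf u\cdot\mathbf n_{K,f})_f\,c_f^{m+1,\mathrm{up}}\,|f|=0,$$ where $c_f^{m+1,\mathrm{up}}=c_K^{m+1}$ if $(\mathbf u\cdot\mathbf n_{K,f})_f\ge 0$; otherwise $c_f^{m+1,\mathrm{up}}=c_L^{m+1}$ if $f=K|L$ is interior, and it is the prescribed inflow concentration if $f$ is a boundary face. Written as a linear system for the vector of cell values at $t^{m+1}$, this is $A_{\mathrm{up}}c=b$, where $A_{\mathrm{up}}=\frac1{\Delta t}D+\mathcal V$ with $D:=\mathrm{diag}(\varepsilon|K|)$ and $\mathcal V$ the matrix of the upwind flux sum acting on the unknown cell values (boundary inflow state replaced by $0$), and $b$ collects the previous-step term $\frac1{\Delta t}Dc^m$ and the prescribed boundary inflow contributions. Norms: for a cellwise scalar field $v=\{v_K\}$, $$\|v\|_D^2:=\sum_K(\varepsilon|K|)\,v_K^2,\qquad \alpha_f:=\big|(\mathbf u\cdot\mathbf n_{K,f})_f\big|\,|f|,\qquad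 |v|_{\mathrm{up}}^2:=\frac12\sum_{f=K|L}\alpha_f\,(v_K-v_L)^2,$$ the last sum running over interior faces, and $$\|v\|_{\mathcal E,\mathrm{tr}}^2:=\frac1{\Delta t}\|v\|_D^2+|v|_{\mathrm{up}}^2 .$$ *)

(* Defs.v *)
(* MathComp, over the real numbers of MathComp-Analysis. *)
From HB Require Import structures.
From mathcomp Require Import all_boot all_order all_algebra.
From mathcomp Require Import reals ring.
Set Implicit Arguments.
Unset Strict Implicit.
Unset Printing Implicit Defensive.
Import Order.TTheory GRing.Theory Num.Theory.
Local Open Scope ring_scope.

(* Cells are indexed by 'I_n and faces by 'I_m. A face f has a first cell
   [owner f]; [neigh f = Some L] means f = K|L with K = owner f, and
   [neigh f = None] means that f is a boundary face. Which of the two cells of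
   an interior face is the owner is an arbitrary labelling. Two cells may share
   several faces. *)
Record cv_mesh (R : realType) (d n m : nat) := CVMesh {
  cell_measure : 'I_n -> R;
  face_measure : 'I_m -> R;
  owner : 'I_m -> 'I_n;
  neigh : 'I_m -> option 'I_n;
  owner_normal : 'I_m -> 'rV[R]_d;
  cell_measure_gt0 : forall K, 0 < cell_measure K;
  face_measure_ge0 : forall f, 0 <= face_measure f;
  neigh_neq_owner : forall f, neigh f <> Some (owner f);
  owner_normal_unit : forall f, \sum_i owner_normal f 0 i ^+ 2 = 1
}.

Section Transport.
Context {R : realType} {d n m : nat}.
Variable T : cv_mesh R d n m.

Definition is_face_of (K : 'I_n) (f : 'I_m) : bool :=
  (owner T f == K) || (neigh T f == Some K).

(* The cell on the other side of f seen from K, for f a face of K. *)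
Definition opposite (K : 'I_n) (f : 'I_m) : option 'I_n :=
  if owner T f == K then neigh T f else Some (owner T f).

(* The unit normal on f outward from K, for f a face of K. *)
Definition outward_normal (K : 'I_n) (f : 'I_m) : 'rV[R]_d :=
  if owner T f == K then owner_normal T f else - owner_normal T f.

(* [u f] is a face value of the velocity; only its normal component is used,
   so that any single-valued normal velocity is of this form. *)
Variable u : 'I_m -> 'rV[R]_d.

Definition normal_velocity (K : 'I_n) (f : 'I_m) : R :=
  \sum_i u f 0 i * outward_normal K f 0 i.

(* [cin f] is the prescribed inflow concentration; its values at faces that are
   not inflow boundary faces are irrelevant. *)
Definition upwind_value (cin : 'I_m -> R) (v : 'cV[R]_n) (K : 'I_n)
    (f : 'I_m) : R :=
  if 0 <= normal_velocity K f then v K 0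
  else if opposite K f is Some L then v L 0 else cin f.

Definition upwind_flux (cin : 'I_m -> R) (v : 'cV[R]_n) (K : 'I_n) : R :=
  \sum_(f | is_face_of K f)
    normal_velocity K f * upwind_value cin v K f * face_measure T f.

Definition upwind_mx : 'M[R]_n :=
  \matrix_(K, L) upwind_flux (fun=> 0) (delta_mx L 0) K.

Definition inflow (cin : 'I_m -> R) : 'cV[R]_n :=
  \col_K - \sum_(f | is_face_of K f &&
                     (opposite K f == None) && (normal_velocity K f < 0))
             normal_velocity K f * cin f * face_measure T f.

Variables (eps dt : R).

Definition mass_mx : 'M[R]_n := diag_mx (\row_K (eps * cell_measure T K)).

Definition A_up : 'M[R]_n := dt^-1 *: mass_mx + upwind_mx.

Definition rhs (cm : 'cV[R]_n) (cin : 'I_m -> R) : 'cV[R]_n :=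
  dt^-1 *: (mass_mx *m cm) + inflow cin.

Definition normD_sq (v : 'cV[R]_n) : R :=
  \sum_K (eps * cell_measure T K) * v K 0 ^+ 2.

Definition face_weight (f : 'I_m) : R :=
  `|normal_velocity (owner T f) f| * face_measure T f.

Definition seminorm_up_sq (v : 'cV[R]_n) : R :=
  2^-1 * \sum_f (if neigh T f is Some L
                 then face_weight f * (v (owner T f) 0 - v L 0) ^+ 2 else 0).

Definition energy_norm (v : 'cV[R]_n) : R :=
  Num.sqrt (dt^-1 * normD_sq v + seminorm_up_sq v).

Lemma upwind_mxE (v : 'cV[R]_n) (K : 'I_n) :
  (upwind_mx *m v) K 0 = upwind_flux (fun=> 0) v K.
Proof.
rewrite mxE; under eq_bigr do rewrite mxE mulr_suml.
rewrite exchange_big; apply: eq_bigr => f _.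
transitivity (normal_velocity K f * face_measure T f *
    \sum_L upwind_value (fun=> 0) (delta_mx L 0) K f * v L 0).
  by rewrite mulr_sumr; apply: eq_bigr => L _; rewrite -!mulrA; congr (_ * _);
     rewrite mulrCA.
have sumE J : \sum_L (delta_mx L 0 : 'cV[R]_n) J 0 * v L 0 = v J 0.
  rewrite (bigD1 J) //= big1 ?addr0; last first.
    by move=> L LJ; rewrite mxE eq_sym (negbTE LJ) mul0r.
  by rewrite mxE !eqxx mul1r.
rewrite mulrAC; congr (_ * _ * _); rewrite /upwind_value.
case: ifP => _; first exact: sumE.
case: (opposite K f) => [L|]; first exact: sumE.
by rewrite big1 // => L _; rewrite mul0r.
Qed.

(* The linear system is the control-volume balance over one substep. *)
Lemma A_up_balance (cm c : 'cV[R]_n) (cin : 'I_m -> R) :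
  A_up *m c = rhs cm cin <->
  (forall K, eps * ((c K 0 - cm K 0) / dt) * cell_measure T K
             + upwind_flux cin c K = 0).
Proof.
have E K : (A_up *m c) K 0 - rhs cm cin K 0 =
    eps * ((c K 0 - cm K 0) / dt) * cell_measure T K + upwind_flux cin c K.
  rewrite mulmxDl -scalemxAl mxE upwind_mxE /rhs /mass_mx.
  rewrite !mul_diag_mx !mxE.
  have -> : upwind_flux cin c K = upwind_flux (fun=> 0) c K +
      \sum_(f | is_face_of K f && (opposite K f == None)
                && (normal_velocity K f < 0))
         normal_velocity K f * cin f * face_measure T f.
    under [in RHS]eq_bigl do rewrite -andbA.
    rewrite big_mkcondr -big_split /=; apply: eq_bigr => f _.
    rewrite /upwind_value ltNge; case: leP => _ /=.
      by rewrite andbF addr0.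
    by case: (opposite K f) => [L|] /=; rewrite ?addr0 // mulr0 mul0r add0r.
  set F := upwind_flux _ _ _; set S := \sum_(_ | _) _.
  by ring.
split=> [H K|H]; first by rewrite -E H subrr.
by apply/colP => K; apply/eqP; rewrite -subr_eq0 E H.
Qed.

End Transport.

Definition euclidean_norm {R : realType} {n : nat} (v : 'cV[R]_n) : R :=
  Num.sqrt (\sum_K v K 0 ^+ 2).

(* Main.v *)
Require Import Defs.
From mathcomp Require Import all_boot all_order all_algebra.
From mathcomp Require Import reals ring.
Set Implicit Arguments.
Unset Strict Implicit.
Unset Printing Implicit Defensive.
Import Order.TTheory GRing.Theory Num.Theory.
Local Open Scope ring_scope.

(** The velocity is not assumed to be discretely divergence free, so [A_up] need
    not be coercive for the energy norm: the symmetric part of the upwind matrix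
    may be indefinite. The stability estimate comes from the l^1 norm instead.
    By conservativity, what leaves a cell through an interior face enters the
    neighbouring cell, so each column of the upwind matrix has a nonnegative
    diagonal entry, nonpositive off-diagonal entries, and a nonnegative sum (the
    outflow through the boundary). Adding the positive diagonal mass term makes
    [A_up] strictly diagonally dominant by columns, whence
        dt^-1 * \sum_K eps |K| |v_K| <= \sum_K |(A_up v)_K|.
    The proof tests [A_up v] against the signs of the entries of [v]: the mass
    term gives the left-hand side, and the faces contribute nonnegatively
    ([sg_upwind_flux_ge0]).

    The residual is [A_up] applied to the error, so both inequalities follow by
    comparing the Euclidean and the energy norm with the l^1 norm, all three
    being norms on a finite dimensional space. *)

(** * Comparison of norms with the l^1 norm *)

Section Norm1.
Context {R : realType}.

Definition norm1 {n : nat} (v : 'cV[R]_n) : R := \sum_K `|v K 0|.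

Lemma norm1_ge0 n (v : 'cV[R]_n) : 0 <= norm1 v.
Proof. by apply: sumr_ge0 => K _; apply: normr_ge0. Qed.

Lemma abs_le_norm1 n (v : 'cV[R]_n) K : `|v K 0| <= norm1 v.
Proof. by rewrite /norm1 (bigD1 K) //= lerDl sumr_ge0. Qed.

Lemma abs_le_euclidean n (v : 'cV[R]_n) K : `|v K 0| <= euclidean_norm v.
Proof.
rewrite -sqrtr_sqr ler_wsqrtr // (bigD1 K) //= lerDl.
by apply: sumr_ge0 => L _; apply: sqr_ge0.
Qed.

Lemma norm1_le_euclidean n (v : 'cV[R]_n) :
  norm1 v <= n%:R * euclidean_norm v.
Proof.
apply: (le_trans (ler_sum _ (fun K _ => abs_le_euclidean v K))).
by rewrite sumr_const card_ord mulr_natl.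
Qed.

Lemma euclidean_le_norm1 n (v : 'cV[R]_n) : euclidean_norm v <= norm1 v.
Proof.
rewrite -[leRHS]ger0_norm ?norm1_ge0 // -sqrtr_sqr ler_wsqrtr //.
rewrite expr2 {1}/norm1 mulr_suml; apply: ler_sum => K _.
by rewrite -real_normK ?num_real // expr2 ler_wpM2l ?abs_le_norm1.
Qed.

Lemma norm1_mulmx_le n (A : 'M[R]_n) (v : 'cV[R]_n) :
  norm1 (A *m v) <= (\sum_K \sum_L `|A K L|) * norm1 v.
Proof.
rewrite mulr_suml; apply: ler_sum => K _.
rewrite mxE mulr_suml; apply: (le_trans (ler_norm_sum _ _ _)).
by apply: ler_sum => L _; rewrite normrM ler_wpM2l ?abs_le_norm1.
Qed.

End Norm1.

Section Stability.
Context {R : realType} {d n m : nat}.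
Variables (T : cv_mesh R d n m) (u : 'I_m -> 'rV[R]_d) (eps dt : R).
Hypotheses (eps_gt0 : 0 < eps) (dt_gt0 : 0 < dt).

(** * Stability of the upwind matrix in the l^1 norm *)

(** A face is counted once for each of its cells, and these are distinct. *)
Lemma sum_face_cells (f : 'I_m) (G : 'I_n -> R) :
  \sum_(K | is_face_of T K f) G K =
    G (owner T f) + (if neigh T f is Some L then G L else 0).
Proof.
rewrite (bigD1 (owner T f)) /=; last by rewrite /is_face_of eqxx.
congr (_ + _); have := @neigh_neq_owner _ _ _ _ T f.
rewrite /is_face_of; case: (neigh T f) => [L|] hL.
  rewrite (big_pred1 L) // => K /=; rewrite /= [owner T f == K]eq_sym.
  have -> : (Some L == Some K) = (K == L) by rewrite eq_sym.
  case: (K =P L) => [->|_]; last by rewrite orbF andbN.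
  by rewrite orbT /=; apply/eqP => e; apply: hL; rewrite e.
by apply: big_pred0 => K; rewrite orbF eq_sym andbN.
Qed.

Lemma normal_velocity_neigh (f : 'I_m) (L : 'I_n) : neigh T f = Some L ->
  normal_velocity T u L f = - normal_velocity T u (owner T f) f.
Proof.
move=> hL; rewrite /normal_velocity /outward_normal eqxx.
have /negbTE -> : owner T f != L.
  by apply/eqP => e; apply: (@neigh_neq_owner _ _ _ _ T f); rewrite hL e.
by rewrite -sumrN; apply: eq_bigr => i _; rewrite mxE mulrN.
Qed.

(** The two cells sharing a face agree on its upwind state unless the normal
    velocity vanishes, a case in which both fluxes are zero. *)
Lemma upwind_conservative cin (v : 'cV[R]_n) (f : 'I_m) (L : 'I_n) :
  neigh T f = Some L ->
  normal_velocity T u L f * upwind_value T u cin v L f =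
  - (normal_velocity T u (owner T f) f * upwind_value T u cin v (owner T f) f).
Proof.
move=> hL; rewrite /upwind_value (normal_velocity_neigh hL) /opposite eqxx hL.
have /negbTE -> : owner T f != L.
  by apply/eqP => e; apply: (@neigh_neq_owner _ _ _ _ T f); rewrite hL e.
rewrite oppr_ge0 mulNr.
by case: (ltgtP (normal_velocity T u (owner T f) f) 0) => [||->] //=;
  rewrite !mul0r.
Qed.

Lemma mulr_sg_sub_ge0 (x y : R) : 0 <= x * (Num.sg x - Num.sg y).
Proof.
rewrite mulrBr [x * Num.sg x]mulrC -normrEsg subr_ge0.
apply: (le_trans (ler_norm _)); rewrite normrM normr_sg.
by apply: ler_piMr => //; case: eqP.
Qed.

(** Summed over the cells, the fluxes regroup face by face. An interior face
    contributes its outgoing flux times the difference of the upstream and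
    downstream signs, and the flux has the sign of the upstream value; a
    boundary face contributes only when it is an outflow face. *)
Lemma sg_upwind_flux_ge0 (v : 'cV[R]_n) :
  0 <= \sum_K Num.sg (v K 0) * upwind_flux T u (fun=> 0) v K.
Proof.
under eq_bigr do rewrite mulr_sumr.
rewrite (exchange_big_dep predT) //=; apply: sumr_ge0 => f _.
rewrite sum_face_cells; set K := owner T f.
set a := normal_velocity T u K f.
case hL: (neigh T f) => [L|].
  rewrite (upwind_conservative _ _ hL) -/K -/a.
  set w := upwind_value _ _ _ _ _ _.
  have -> : Num.sg (v K 0) * (a * w * face_measure T f) +
      Num.sg (v L 0) * (- (a * w) * face_measure T f) =
      a * (w * (Num.sg (v K 0) - Num.sg (v L 0))) * face_measure T f by ring.
  apply: mulr_ge0; last exact: face_measure_ge0.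
  rewrite /w /upwind_value -/a /opposite eqxx hL.
  case: (leP 0 a) => ha; first by rewrite mulr_ge0 ?mulr_sg_sub_ge0.
  by rewrite -mulrNN -mulrN opprB mulr_ge0 ?mulr_sg_sub_ge0 ?oppr_ge0 ?ltW.
rewrite addr0 /upwind_value -/a /opposite eqxx hL.
case: (leP 0 a) => ha; last by rewrite mulr0 mul0r mulr0.
rewrite mulrA mulrCA -normrEsg.
by rewrite !mulr_ge0 ?face_measure_ge0.
Qed.

Lemma A_upE (v : 'cV[R]_n) (K : 'I_n) :
  (A_up T u eps dt *m v) K 0 =
    dt^-1 * (eps * cell_measure T K) * v K 0 + upwind_flux T u (fun=> 0) v K.
Proof.
by rewrite mulmxDl -scalemxAl mxE upwind_mxE /mass_mx mul_diag_mx !mxE mulrA.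
Qed.

(** Strict diagonal dominance by columns, in the form of an l^1 bound: each sign
    is at most 1 in absolute value, so the right-hand side dominates the sum of
    [A_up v] against the signs of [v]. *)
Lemma mass_norm1_le_A_up (v : 'cV[R]_n) :
  \sum_K dt^-1 * (eps * cell_measure T K) * `|v K 0|
    <= norm1 (A_up T u eps dt *m v).
Proof.
apply: (@le_trans _ _ (\sum_K Num.sg (v K 0) * (A_up T u eps dt *m v) K 0)).
  under [leRHS]eq_bigr do rewrite A_upE mulrDr mulrCA -normrEsg.
  by rewrite big_split /= lerDl sg_upwind_flux_ge0.
apply: ler_sum => K _; apply: (le_trans (ler_norm _)); rewrite normrM normr_sg.
by apply: ler_piMl => //; case: eqP.
Qed.

Lemma mass_gt0 (K : 'I_n) : 0 < dt^-1 * (eps * cell_measure T K).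
Proof. by rewrite !mulr_gt0 ?invr_gt0 ?cell_measure_gt0. Qed.

Lemma norm1_le_A_up (v : 'cV[R]_n) :
  norm1 v <= (\sum_K (dt^-1 * (eps * cell_measure T K))^-1)
             * norm1 (A_up T u eps dt *m v).
Proof.
rewrite mulr_suml; apply: ler_sum => K _.
rewrite ler_pdivlMl ?mass_gt0 //; apply: le_trans (mass_norm1_le_A_up v).
rewrite [leRHS](bigD1 K) //= lerDl; apply: sumr_ge0 => L _.
by rewrite mulr_ge0 // ltW // mass_gt0.
Qed.

(** * Comparison of the energy norm with the l^1 norm *)

Lemma face_weight_ge0 (f : 'I_m) : 0 <= face_weight T u f.
Proof. by rewrite mulr_ge0 ?face_measure_ge0. Qed.

Lemma mass_energyE (v : 'cV[R]_n) :
  dt^-1 * normD_sq T eps v =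
    \sum_K dt^-1 * (eps * cell_measure T K) * v K 0 ^+ 2.
Proof. by rewrite mulr_sumr; apply: eq_bigr => K _; rewrite mulrA. Qed.

Lemma seminorm_up_sq_ge0 (v : 'cV[R]_n) : 0 <= seminorm_up_sq T u v.
Proof.
rewrite mulr_ge0 ?invr_ge0 ?ler0n //; apply: sumr_ge0 => f _.
by case: (neigh T f) => // L; rewrite mulr_ge0 ?face_weight_ge0 ?sqr_ge0.
Qed.

Lemma norm1_le_energy (v : 'cV[R]_n) :
  norm1 v <= (\sum_K (Num.sqrt (dt^-1 * (eps * cell_measure T K)))^-1)
             * energy_norm T u eps dt v.
Proof.
rewrite mulr_suml; apply: ler_sum => K _.
rewrite ler_pdivlMl ?sqrtr_gt0 ?mass_gt0 //.
rewrite -sqrtr_sqr -sqrtrM ?(ltW (mass_gt0 K)) //.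
rewrite ler_wsqrtr // mass_energyE (bigD1 K) //= -addrA lerDl.
rewrite addr_ge0 ?seminorm_up_sq_ge0 //; apply: sumr_ge0 => L _.
by rewrite mulr_ge0 ?sqr_ge0 // ltW // mass_gt0.
Qed.

(** The factor 2 ^ 2 bounds a squared jump: |v_K - v_L| <= 2 |v|_1. *)
Lemma energy_le_norm1 (v : 'cV[R]_n) :
  energy_norm T u eps dt v <=
    Num.sqrt (\sum_K dt^-1 * (eps * cell_measure T K)
              + 2^-1 * \sum_f face_weight T u f * 2 ^+ 2) * norm1 v.
Proof.
rewrite -[norm1 v]ger0_norm ?norm1_ge0 // -sqrtr_sqr -sqrtrM; last first.
  apply: addr_ge0; first by apply: sumr_ge0 => K _; rewrite ltW // mass_gt0.
  rewrite mulr_ge0 ?invr_ge0 ?ler0n //; apply: sumr_ge0 => f _.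
  by rewrite mulr_ge0 ?face_weight_ge0 ?sqr_ge0.
rewrite ler_wsqrtr // mass_energyE mulrDl; apply: lerD.
  rewrite mulr_suml; apply: ler_sum => K _.
  apply: ler_wpM2l; first by rewrite ltW // mass_gt0.
  by rewrite -real_normK ?num_real // lerXn2r ?nnegrE ?norm1_ge0 ?abs_le_norm1.
rewrite -mulrA ler_wpM2l ?invr_ge0 ?ler0n // mulr_suml; apply: ler_sum => f _.
rewrite -mulrA -exprMn; case: (neigh T f) => [L|]; last first.
  by rewrite mulr_ge0 ?face_weight_ge0 ?sqr_ge0.
rewrite ler_wpM2l ?face_weight_ge0 // -real_normK ?num_real //.
rewrite lerXn2r ?nnegrE ?mulr_ge0 ?norm1_ge0 ?ler0n //.
by rewrite mulr_natl mulr2n (le_trans (ler_normB _ _)) ?lerD ?abs_le_norm1.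
Qed.

(** * Equivalence of the residual and the energy norm *)

Lemma energy_le_A_up : exists2 C : R, 0 <= C & forall v : 'cV[R]_n,
  energy_norm T u eps dt v <= C * euclidean_norm (A_up T u eps dt *m v).
Proof.
eexists; last first.
  move=> v; apply: (le_trans (energy_le_norm1 v)).
  apply: (le_trans (ler_wpM2l (sqrtr_ge0 _) (norm1_le_A_up v))).
  rewrite mulrA; apply: le_trans (ler_wpM2l _ (norm1_le_euclidean _)) _.
    rewrite mulr_ge0 ?sqrtr_ge0 //; apply: sumr_ge0 => K _.
    by rewrite invr_ge0 ltW // mass_gt0.
  by rewrite mulrA.
rewrite !mulr_ge0 ?sqrtr_ge0 ?ler0n //; apply: sumr_ge0 => K _.
by rewrite invr_ge0 ltW // mass_gt0.
Qed.

Lemma A_up_le_energy : exists2 C : R, 0 <= C & forall v : 'cV[R]_n,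
  euclidean_norm (A_up T u eps dt *m v) <= C * energy_norm T u eps dt v.
Proof.
have A_ge0 : 0 <= \sum_K \sum_L `|A_up T u eps dt K L|.
  by apply: sumr_ge0 => K _; apply: sumr_ge0.
eexists; last first.
  move=> v; apply: (le_trans (euclidean_le_norm1 _)).
  apply: (le_trans (norm1_mulmx_le _ _)).
  apply: (le_trans (ler_wpM2l A_ge0 (norm1_le_energy v))).
  by rewrite mulrA.
by rewrite mulr_ge0 //; apply: sumr_ge0 => K _; rewrite invr_ge0 sqrtr_ge0.
Qed.

End Stability.

Theorem lemma3 (R : realType) (d n m : nat) (T : cv_mesh R d n m)
    (u : 'I_m -> 'rV[R]_d) (eps dt : R) (heps : 0 < eps) (hdt : 0 < dt)
    (cm : 'cV[R]_n) (cin : 'I_m -> R) (c : 'cV[R]_n)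
    (hc : A_up T u eps dt *m c = rhs T u eps dt cm cin) :
  exists C1 C2 : R, 0 < C1 /\ 0 < C2 /\
    forall ctilde : 'cV[R]_n,
      C1 * energy_norm T u eps dt (ctilde - c)
        <= euclidean_norm (A_up T u eps dt *m ctilde - rhs T u eps dt cm cin)
      /\ euclidean_norm (A_up T u eps dt *m ctilde - rhs T u eps dt cm cin)
        <= C2 * energy_norm T u eps dt (ctilde - c).
Proof.
have [C C0 lowerC] := energy_le_A_up T u heps hdt.
have [C' C'0 upperC] := A_up_le_energy T u heps hdt.
(* The bounds of the two lemmas may vanish (for instance on an empty mesh);
   adding 1 makes them positive. *)
exists (C + 1)^-1, (C' + 1); rewrite invr_gt0 !ltr_wpDl //; do 2!split=> //.
move=> ctilde; rewrite -hc -mulmxBr; split.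
  rewrite ler_pdivrMl ?ltr_wpDl //; apply: (le_trans (lowerC _)).
  by rewrite ler_wpM2r ?sqrtr_ge0 // lerDl.
by apply: (le_trans (upperC _)); rewrite ler_wpM2r ?sqrtr_ge0 // lerDl.
Qed.
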